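(* Let $G$ be a finite simple graph with vertex set $\{x_1,\ldots,x_n\}$ and let $a=(1,\ldots,1)\in\mathbb{N}^n$. Then $a$ is a reducible $\alpha_0(G)$-cover of $\Upsilon(G)$ if and only if there are induced subgraphs $H_1$ and $H_2$ of $G$, each with nonempty vertex set, such that (i) $V(G)$ is the disjoint union of $V(H_1)$ and $V(H_2)$, and (ii) $\alpha_0(G)=\alpha_0(H_1)+\alpha_0(H_2)$.
   Context: $\mathbb{N}=\{0,1,2,\ldots\}$. A vertex cover of a graph is a set of vertices meeting every edge; it is minimal if no proper subset is a vertex cover. $\Upsilon(G)$, the blocker of $G$, is the family of all minimal vertex covers of $G$. The vertex covering number $\alpha_0(G)$ is the minimum cardinality of a vertex cover of $G$ (so $\alpha_0=0$ for a graph without edges). For $0\neq a\in\mathbb{N}^n$ and $b\in\mathbb{N}$, $a$ is a $b$-cover of $\Upsilon(G)$ if $\sum_{x_i\in C}a_i\geq b$ for every $C\in\Upsilon(G)$. A $b$-cover $a$ of $\Upsilon(G)$ is reducible if there are an $i$-cover $c$ and a $j$-cover $d$ of $\Upsilon(G)$ (with $i,j\in\mathbb{N}$; covers are nonzero vectors by definition) such that $a=c+d$ and $b=i+j$. *)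

(* Defs.v *)
From mathcomp Require Import all_boot all_order all_algebra.
Set Implicit Arguments.
Unset Strict Implicit.
Unset Printing Implicit Defensive.

(* A simple graph whose vertex set is the whole finite type T. *)
Record sgraph (T : finType) := SGraph {
  adj :> rel T;
  adj_sym : symmetric adj;
  adj_irr : irreflexive adj
}.

Section Induced.
Variables (T : finType) (G : sgraph T) (S : {set T}).

Definition induced_rel : rel {x : T | x \in S} :=
  fun x y => adj G (val x) (val y).

Lemma induced_sym : symmetric induced_rel.
Proof. by move=> x y; rewrite /induced_rel adj_sym. Qed.

Lemma induced_irr : irreflexive induced_rel.
Proof. by move=> x; rewrite /induced_rel adj_irr. Qed.

(* The vertices of the induced subgraph form the subtype of T cut out by S,
   so its own vertex covers are sets over that subtype. *)
Definition induced : sgraph {x : T | x \in S} := SGraph induced_sym induced_irr.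

End Induced.

Section Covers.
Variable T : finType.
Implicit Types (G : sgraph T) (C : {set T}) (F : {set {set T}}).
Implicit Types (a c d : {ffun T -> nat}) (b i j : nat).

Definition vertex_cover G C : bool :=
  [forall x, forall y, adj G x y ==> (x \in C) || (y \in C)].

Lemma vertex_coverT G : vertex_cover G setT.
Proof. by apply/forallP=> x; apply/forallP=> y; rewrite inE implybT. Qed.

Definition blocker G : {set {set T}} := [set C | minset (vertex_cover G) C].

(* The default value setT is itself a vertex cover (vertex_coverT), so the
   minimum is attained. *)
Definition alpha0 G : nat :=
  #|[arg min_(C < [set: T] | vertex_cover G C) #|C| ]|.

Lemma alpha0P G :
  (exists2 C, vertex_cover G C & #|C| = alpha0 G)
  /\ (forall C, vertex_cover G C -> alpha0 G <= #|C|).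
Proof.
rewrite /alpha0; case: arg_minnP => [|C covC minC]; first exact: vertex_coverT.
by split; first exists C.
Qed.

Definition is_cover F b a : Prop :=
  a <> 0%R /\ forall C, C \in F -> b <= \sum_(x in C) a x.

Definition reducible_cover F b a : Prop :=
  is_cover F b a /\
  exists i j c d,
    [/\ is_cover F i c, is_cover F j d, a = (c + d)%R & b = i + j].

End Covers.

(* Main.v *)
Require Import Defs.
From mathcomp Require Import all_boot all_order all_algebra.

(** A splitting [1 = c + d] of the all-ones vector is a partition of the
    vertices into the supports [S1], [S2] of [c] and [d].  For every set [S] of
    vertices, [alpha0 (induced G S)] is the minimum of [#|C :&: S|] over the
    minimal vertex covers [C] of [G]: traces of covers of [G] cover the induced
    subgraph, and conversely a cover [D] of the induced subgraph extends to the
    cover [D :|: ~: S] of [G].  So the indicator of [S] is a [b]-cover of the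
    blocker iff [b <= alpha0 (induced G S)]; together with the inequality
    [alpha0 (induced G S1) + alpha0 (induced G S2) <= alpha0 G] this gives both
    directions. *)

Section InducedCovers.
Variables (T : finType) (G : sgraph T).
Implicit Types (C S : {set T}) (b : nat).

Lemma vertex_coverP C :
  reflect (forall x y, adj G x y -> (x \in C) || (y \in C)) (vertex_cover G C).
Proof.
apply: (iffP forallP) => [cov x y | cov x].
  by move/forallP/(_ y)/implyP: (cov x).
by apply/forallP => y; apply/implyP/cov.
Qed.

Lemma blocker_cover C : C \in blocker G -> vertex_cover G C.
Proof. by rewrite inE => /minsetp. Qed.

(** Every vertex cover contains a minimal one, and the entries of [a] are natural numbers, so
    passing to the larger set cannot decrease the sum. *)
Lemma is_cover_vertex_cover b (a : {ffun T -> nat}) C :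
  is_cover (blocker G) b a -> vertex_cover G C -> b <= \sum_(x in C) a x.
Proof.
move=> [_ cova] /minset_exists[B minB sBC].
apply: (leq_trans (cova B _)); first by rewrite inE.
rewrite [leqRHS](big_setID B) (setIidPr sBC) /=; exact: leq_addr.
Qed.

Lemma alpha0_induced_leq C S :
  vertex_cover G C -> alpha0 (induced G S) <= #|C :&: S|.
Proof.
move=> /vertex_coverP covC.
have [_ /(_ [set x | val x \in C]) min_alpha] := alpha0P (induced G S).
apply: leq_trans (min_alpha _) _.
  apply/forallP => x; apply/forallP => y; apply/implyP => /covC.
  by rewrite !inE.
rewrite -(card_imset _ val_inj) subset_leq_card //.
apply/subsetP => _ /imsetP[x Cx ->]; rewrite !inE in Cx *.
by rewrite Cx (valP x).
Qed.

Lemma alpha0_induced_lift S :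
  exists2 C, vertex_cover G C & #|C :&: S| = alpha0 (induced G S).
Proof.
have [[D covD <-] _] := alpha0P (induced G S).
exists (val @: D :|: ~: S).
  apply/vertex_coverP => x y Gxy; rewrite !inE.
  (* An edge with an endpoint outside [S] is met by [~: S], so only edges inside [S] are left to
     [D]. *)
  case Sx: (x \in S); last by rewrite orbT.
  case Sy: (y \in S); last by rewrite !orbT.
  move/forallP/(_ (exist _ x Sx))/forallP/(_ (exist _ y Sy))/implyP: covD.
  move=> /(_ Gxy) /orP[] Dz; apply/orP; [left | right]; rewrite orbF.
    exact: (imset_f val Dz).
  exact: (imset_f val Dz).
rewrite setIUl (setIC (~: S)) setICr setU0 -(card_imset _ val_inj).
rewrite (setIidPl _) //.
by apply/subsetP => _ /imsetP[x _ ->]; exact: valP.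
Qed.

(** A minimum cover of [G] has disjoint traces on [S1] and [S2], each at least as large as the
    corresponding [alpha0]. *)
Lemma alpha0_induced_add S1 S2 :
  [disjoint S1 & S2] ->
  alpha0 (induced G S1) + alpha0 (induced G S2) <= alpha0 G.
Proof.
move=> dis; have [[C covC <-] _] := alpha0P G.
apply: leq_trans (leq_add (alpha0_induced_leq _ S1 covC)
  (alpha0_induced_leq _ S2 covC)) _.
rewrite -cardsUI setIACA (disjoint_setI0 dis) setI0 cards0 addn0.
by rewrite subset_leq_card // subUset !subsetIl.
Qed.

Definition indicator S : {ffun T -> nat} := [ffun x => nat_of_bool (x \in S)].

Lemma sum_indicator C S : \sum_(x in C) indicator S x = #|C :&: S|.
Proof.
under eq_bigr do rewrite ffunE.
by rewrite -big_mkcondr sum1_card; apply: eq_card => x; rewrite !inE.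
Qed.

Lemma indicator_neq0 S : indicator S <> 0%R <-> S != set0.
Proof.
split=> [nz | /set0Pn[x Sx] /ffunP/(_ x)]; last by rewrite !ffunE Sx.
by apply/eqP => S0; apply: nz; apply/ffunP => x; rewrite !ffunE S0 inE.
Qed.

Lemma is_cover_indicator b S :
  is_cover (blocker G) b (indicator S) <->
  S != set0 /\ b <= alpha0 (induced G S).
Proof.
split=> [cov | [/indicator_neq0 nz le_b]].
  split; first by apply/indicator_neq0; case: cov.
  (* The lifted cover [C] may fail to be minimal, hence the passage through
     [is_cover_vertex_cover]. *)
  have [C covC <-] := alpha0_induced_lift S.
  by rewrite -sum_indicator; exact: is_cover_vertex_cover.
split=> // C /blocker_cover covC; rewrite sum_indicator.
exact: leq_trans le_b (alpha0_induced_leq _ S covC).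
Qed.

End InducedCovers.

Theorem theorem3p9 (n : nat) (G : sgraph 'I_n) :
  reducible_cover (blocker G) (alpha0 G) [ffun _ : 'I_n => 1] <->
  exists S1 S2 : {set 'I_n},
    [/\ S1 != set0, S2 != set0, [disjoint S1 & S2], S1 :|: S2 = [set: 'I_n]
      & alpha0 G = alpha0 (induced G S1) + alpha0 (induced G S2)].
Proof.
split=> [[_ [i [j [c [d [covc covd cd1 def_alpha]]]]]] | [S1 [S2 [nz1 nz2 dis cover def_alpha]]]].
  have cd x : 1 = c x + d x by move/ffunP/(_ x): cd1; rewrite !ffunE.
  (* Over the naturals [1 = c x + d x] forces one term to be 1 and the other 0. *)
  pose S1 := [set x | c x == 1]; pose S2 := [set x | d x == 1].
  have def_c : c = indicator _ S1.
    by apply/ffunP => x; rewrite ffunE inE; case: (c x) (cd x) => [|[|k]].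
  have def_d : d = indicator _ S2.
    apply/ffunP => x; rewrite ffunE inE.
    by case: (c x) (d x) (cd x) => [|[|k]] [|[|l]].
  rewrite def_c in covc; rewrite def_d in covd.
  move/is_cover_indicator: covc => [nz1 le_i].
  move/is_cover_indicator: covd => [nz2 le_j].
  have dis : [disjoint S1 & S2].
    rewrite -setI_eq0; apply/eqP/setP => x; rewrite !inE.
    by case: (c x) (d x) (cd x) => [|[|k]] [|[|l]].
  exists S1, S2; split=> //.
    apply/setP => x; rewrite !inE.
    by case: (c x) (d x) (cd x) => [|[|k]] [|[|l]].
  (* The bound [<=] comes from [alpha0 G = i + j] with [le_i] and [le_j]; the reverse one is
     superadditivity. *)
  by apply/eqP; rewrite eqn_leq alpha0_induced_add // def_alpha leq_add.
split.
  (* A vertex of [S1] witnesses that the all-ones vector is nonzero. *)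
  split=> [/ffunP one0 | C /blocker_cover covC].
    by have /set0Pn[x _] := nz1; have := one0 x; rewrite !ffunE.
  under eq_bigr do rewrite ffunE.
  by rewrite sum1_card; apply: (proj2 (alpha0P G)).
(* These are the largest [i] and [j] that [is_cover_indicator] allows for the two indicators. *)
exists (alpha0 (induced G S1)), (alpha0 (induced G S2)).
exists (indicator _ S1), (indicator _ S2).
split=> //; try by apply/is_cover_indicator.
apply/ffunP => x; rewrite !ffunE.
have := in_setT x; rewrite -cover inE.
by case: (boolP (x \in S1)) => [S1x _ | _ /= ->] //; rewrite (disjointFr dis S1x).
Qed.
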